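(* Let $G\subset S_N^+$ be a quantum permutation group, and let $O$ be the set of orbitals of $G\subset S_N^+$ that are disjoint from the diagonal relation $\{(i,i):1\le i\le N\}$. For each $A\subset O$ define a graph $X_A=(\{1,\dots,N\},E_A)$ with edge set $$E_A:=\bigcup_{o\in A}(o\cup o^{-1}).$$ Then $G\curvearrowright X_A$. Furthermore, if $G\curvearrowright X$ for $X$ a graph on $N$ vertices, then $X=X_A$ for some $A\subset O$.
   Context: A compact quantum group $G$ is given by a Woronowicz algebra: a unital $\mathrm{C}^*$-algebra $C(G)$ generated by the entries of a unitary matrix $u\in M_N(C(G))$ such that there exist $*$-homomorphisms $\Delta:C(G)\to C(G)\otimes C(G)$ (minimal tensor product), $\varepsilon:C(G)\to\mathbb C$, $S:C(G)\to C(G)^{opp}$ with $\Delta(u_{ij})=\sum_k u_{ik}\otimes u_{kj}$, $\varepsilon(u_{ij})=\delta_{ij}$, $S(u_{ij})=u_{ji}^*$. A matrix over a $\mathrm{C}^*$-algebra is magic if its entries are projections ($p^2=p=p^*$) summing to $1$ on each row and each column. Writing $G\subset S_N^+$ means that the fundamental matrix $u\in M_N(C(G))$ is fixed and is magic; such $G$ is a quantum permutation group. The orbitals of $G\subset S_N^+$ are the equivalence classes of the relation on $\{1,\dots,N\}^2$ given by $(i,k)\sim(j,l)\iff u_{ij}u_{kl}\neq 0$ (this is an equivalence relation, and each orbital is either contained in the diagonal or disjoint from it). For an orbital $o$, $o^{-1}=\{(k,i):(i,k)\in o\}$. A finite graph $X=(V,E)$ has vertex set $V=\{1,\dots,N\}$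 and edge set $E\subset V\times V$ a symmetric irreflexive relation; its adjacency matrix is $d\in M_N(0,1)$, with $d_{ij}=1\iff (i,j)\in E$. For $G\subset S_N^+$ and $X$ a graph on $N$ vertices, $G\curvearrowright X$ means $du=ud$. *)

(* Defs.v *)
From HB Require Import structures.
From mathcomp Require Import all_boot all_order all_algebra.
From mathcomp Require Import complex.
From mathcomp Require Import all_classical all_reals.

Set Implicit Arguments.
Unset Strict Implicit.
Unset Printing Implicit Defensive.

Import Order.TTheory GRing.Theory Num.Theory.
Import ComplexField.

Local Open Scope classical_set_scope.
Local Open Scope ring_scope.
Local Open Scope complex_scope.

HB.mixin Record Algebra_hasStar (K : numClosedFieldType) A
    of GRing.Algebra K A := {
  star : A -> A;
  starK : involutive star;
  starD : forall x y : A, star (x + y) = star x + star y;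
  starZ : forall (c : K) (x : A), star (c *: x) = c^* *: star x;
  starM : forall x y : A, star (x * y) = star y * star x
}.

#[short(type="starAlgType")]
HB.structure Definition StarAlgebra (K : numClosedFieldType) :=
  {A of GRing.Algebra K A & Algebra_hasStar K A}.

(* The norm is part of the structure, instead of coming from a normed module of
   the library, whose hierarchy has no join of normed modules with rings. *)
HB.mixin Record StarAlgebra_isCStar (R : realType) A
    of StarAlgebra R[i] A := {
  cnorm : A -> R;
  cnorm_ge0 : forall x, 0 <= cnorm x;
  cnorm_eq0 : forall x, cnorm x = 0 -> x = 0;
  cnormD : forall x y, cnorm (x + y) <= cnorm x + cnorm y;
  cnormZ : forall (c : R[i]) x, cnorm (c *: x) = Normc.normc c * cnorm x;
  cnormM : forall x y, cnorm (x * y) <= cnorm x * cnorm y;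
  cnorm_star_mul : forall x, cnorm (star x * x) = cnorm x ^+ 2;
  cnorm_complete : forall v : nat -> A,
    (forall e, 0 < e -> exists n0, forall m n,
       (n0 <= m)%N -> (n0 <= n)%N -> cnorm (v m - v n) < e) ->
    exists l, forall e, 0 < e -> exists n0, forall n,
      (n0 <= n)%N -> cnorm (v n - l) < e
}.

#[short(type="cstarAlgType")]
HB.structure Definition CStarAlgebra (R : realType) :=
  {A of StarAlgebra R[i] A & StarAlgebra_isCStar R A}.

Definition cnorm_closure (R : realType) (A : cstarAlgType R) (X : set A) :
    set A :=
  [set x | forall e, 0 < e -> exists2 y, X y & cnorm (x - y) < e].

HB.instance Definition _ (K : numClosedFieldType) :=
  Algebra_hasStar.Build K K^o (@Num.Theory.conjCK K)
    (rmorphD (@Num.conj K)) (rmorphM (@Num.conj K))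
    (fun x y : K => etrans (rmorphM (@Num.conj K) x y) (mulrC _ _)).

Record is_star_hom (K : numClosedFieldType) (A B : starAlgType K)
    (f : A -> B) : Prop := {
  star_hom_linear : linear f;
  star_hom1 : f 1 = 1;
  star_homM : {morph f : x y / x * y};
  star_hom_star : {morph f : x / star x}
}.

(* The same thing as a *-homomorphism from A to the opposite algebra of B. *)
Record is_star_antihom (K : numClosedFieldType) (A B : starAlgType K)
    (f : A -> B) : Prop := {
  star_antihom_linear : linear f;
  star_antihom1 : f 1 = 1;
  star_antihomM : forall x y, f (x * y) = f y * f x;
  star_antihom_star : {morph f : x / star x}
}.

Record is_cstar_subalgebra (R : realType) (A : cstarAlgType R)
    (B : set A) : Prop := {
  cstar_sub1 : B 1;
  cstar_subD : forall x y, B x -> B y -> B (x + y);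
  cstar_subZ : forall (c : R[i]) x, B x -> B (c *: x);
  cstar_subM : forall x y, B x -> B y -> B (x * y);
  cstar_sub_star : forall x, B x -> B (star x);
  cstar_sub_closed : cnorm_closure B `<=` B
}.

Definition cstar_generated_by (R : realType) (A : cstarAlgType R)
    (X : set A) : Prop :=
  forall B : set A, is_cstar_subalgebra B -> X `<=` B -> B = [set: A].

Definition lin_indep (K : numClosedFieldType) (V : lmodType K) n
    (v : 'I_n -> V) : Prop :=
  forall c : 'I_n -> K, \sum_i c i *: v i = 0 -> forall i, c i = 0.

(* T is the completion of the algebraic tensor product of A and B for some
   C*-norm, t a b being the image of the elementary tensor of a and b:
   [cstar_tensor_inj] says that the *-homomorphism that t induces on the
   algebraic tensor product is injective (any element of the latter is a sum
   of elementary tensors with linearly independent left factors, and vanishes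
   only if all the right factors do). *)
Record is_cstar_tensor (R : realType) (A B T : cstarAlgType R)
    (t : A -> B -> T) : Prop := {
  cstar_tensor_linl : forall b, linear (t^~ b);
  cstar_tensor_linr : forall a, linear (t a);
  cstar_tensor1 : t 1 1 = 1;
  cstar_tensorM : forall a a' b b', t (a * a') (b * b') = t a b * t a' b';
  cstar_tensor_star : forall a b, t (star a) (star b) = star (t a b);
  cstar_tensor_inj : forall n (a : 'I_n -> A) (b : 'I_n -> B),
    lin_indep a -> \sum_i t (a i) (b i) = 0 -> forall i, b i = 0;
  cstar_tensor_dense : cnorm_closure
    [set x | exists n (a : 'I_n -> A) (b : 'I_n -> B),
       x = \sum_i t (a i) (b i)] = [set: T]
}.

(* The minimal tensor product is the completion for the least C*-norm. *)
Definition is_min_tensor (R : realType) (A B T : cstarAlgType R)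
    (t : A -> B -> T) : Prop :=
  is_cstar_tensor t /\
  forall (T' : cstarAlgType R) (t' : A -> B -> T'), is_cstar_tensor t' ->
  forall n (a : 'I_n -> A) (b : 'I_n -> B),
    cnorm (\sum_i t (a i) (b i)) <= cnorm (\sum_i t' (a i) (b i)).

Definition unitary_mx (K : numClosedFieldType) (A : starAlgType K) N
    (u : 'M[A]_N) : Prop :=
  let ustar := map_mx star u^T in u *m ustar = 1%:M /\ ustar *m u = 1%:M.

Record compactQuantumGroup (R : realType) (N : nat) := CompactQuantumGroup {
  cqg_alg : cstarAlgType R;
  cqg_mx : 'M[cqg_alg]_N;
  cqg_unitary : unitary_mx cqg_mx;
  cqg_generated : cstar_generated_by [set x | exists i j, x = cqg_mx i j];
  cqg_comult : exists (T : cstarAlgType R) (t : cqg_alg -> cqg_alg -> T),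
    is_min_tensor t /\
    exists Delta : cqg_alg -> T, is_star_hom Delta /\
      forall i j, Delta (cqg_mx i j) = \sum_k t (cqg_mx i k) (cqg_mx k j);
  cqg_counit : exists eps : cqg_alg -> R[i]^o, is_star_hom eps /\
    forall i j, eps (cqg_mx i j) = (i == j)%:R;
  cqg_antipode : exists S : cqg_alg -> cqg_alg, is_star_antihom S /\
    forall i j, S (cqg_mx i j) = star (cqg_mx j i)
}.

Definition is_projection (K : numClosedFieldType) (A : starAlgType K)
    (p : A) : Prop := p * p = p /\ star p = p.

Record magic_mx (K : numClosedFieldType) (A : starAlgType K) N
    (u : 'M[A]_N) : Prop := {
  magic_projection : forall i j, is_projection (u i j);
  magic_row : forall i, \sum_j u i j = 1;
  magic_col : forall j, \sum_i u i j = 1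
}.

Definition quantum_permutation_group (R : realType) N
    (G : compactQuantumGroup R N) : Prop := magic_mx (cqg_mx G).

Definition orbital_rel (R : realType) N (G : compactQuantumGroup R N) :
    rel ('I_N * 'I_N) :=
  fun p q => cqg_mx G p.1 q.1 * cqg_mx G p.2 q.2 != 0.

Definition orbitals (R : realType) N (G : compactQuantumGroup R N) :
    {set {set 'I_N * 'I_N}} :=
  equivalence_partition (orbital_rel G) [set: 'I_N * 'I_N]%SET.

Definition diagonal N : {set 'I_N * 'I_N} := [set p | p.1 == p.2]%SET.

Definition offdiag_orbitals (R : realType) N (G : compactQuantumGroup R N) :
    {set {set 'I_N * 'I_N}} :=
  [set o in orbitals G | [disjoint o & diagonal N]]%SET.

Definition converse_rel N (o : {set 'I_N * 'I_N}) : {set 'I_N * 'I_N} :=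
  [set p | (p.2, p.1) \in o]%SET.

Record graph (N : nat) := Graph {
  edges : {set 'I_N * 'I_N};
  edges_sym : [forall i, forall j, ((i, j) \in edges) ==> ((j, i) \in edges)];
  edges_irr : [forall i, (i, i) \notin edges]
}.

Definition adjacency_mx (A : pzRingType) N (X : graph N) : 'M[A]_N :=
  \matrix_(i, j) ((i, j) \in edges X)%:R.

Definition acts_on_graph (R : realType) N (G : compactQuantumGroup R N)
    (X : graph N) : Prop :=
  let d := adjacency_mx (cqg_alg G) X in
  d *m cqg_mx G = cqg_mx G *m d.

Definition orbital_edges N (A : {set {set 'I_N * 'I_N}}) :
    {set 'I_N * 'I_N} := (\bigcup_(o in A) (o :|: converse_rel o))%SET.

Lemma orbital_edges_sym N (A : {set {set 'I_N * 'I_N}}) :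
  [forall i, forall j,
     ((i, j) \in orbital_edges A) ==> ((j, i) \in orbital_edges A)].
Proof.
apply/forallP => i; apply/forallP => j; apply/implyP => /bigcupP[o oA ijo].
by apply/bigcupP; exists o => //; move: ijo; rewrite !inE orbC.
Qed.

Lemma orbital_edges_irr (R : realType) N (G : compactQuantumGroup R N)
    (A : {set {set 'I_N * 'I_N}}) :
  A \subset offdiag_orbitals G -> [forall i, (i, i) \notin orbital_edges A].
Proof.
move=> /fintype.subsetP sAO; apply/forallP => i; apply/negP => /bigcupP[o /sAO].
rewrite !inE => /andP[_ /disjointFr dis]; rewrite orbb => /dis.
by rewrite inE eqxx.
Qed.

Definition orbital_graph (R : realType) N (G : compactQuantumGroup R N)
    (A : {set {set 'I_N * 'I_N}}) (sAO : A \subset offdiag_orbitals G) :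
    graph N :=
  Graph (orbital_edges_sym A) (orbital_edges_irr sAO).

(* Main.v *)
Require Import Defs.
From mathcomp Require Import all_boot all_order all_algebra complex.
From mathcomp Require Import all_classical all_reals lra.

Set Implicit Arguments.
Unset Strict Implicit.
Unset Printing Implicit Defensive.

Import Order.TTheory GRing.Theory Num.Theory.

Local Open Scope ring_scope.

(** Three facts carry the proof.

    Orthogonality.  Projections of a C*-algebra that sum to 1 are pairwise
    orthogonal ([projections_sum1_orthogonal]).  Compressing by a projection
    [e = p j] turns the sum into [\sum_(k != j) e * p k * e = 0], a sum of
    elements that ought to be positive.  Instead of positivity, the argument
    uses that the unit [e] of the corner [e A e] is an extreme point of its
    unit ball: each [e - 2 e p_k e] is a contraction, so [e] plus or minus a
    positive multiple of [e * p i * e] is a contraction too, and this forces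
    [e * p i * e = 0].  The extremality comes from a doubling argument: if
    [e + c a] is a contraction for the four c with c^4 = 1, then
    [((e + c a)^2 + (e + i c a)^2) / 2 = e + (1 + i) c a] shows the same for
    [(1 + i) a], hence for [2 a], hence for all [2^n a], so that [a = 0].

    Orbitals.  The relation (i, k) ~ (j, l) is reflexive by the counit and
    symmetric by the antipode.  It is transitive by the comultiplication: by
    orthogonality, multiplying Delta (u_im u_kn) by [u_ij (x) u_jm] on the left
    and by [u_kl (x) u_ln] on the right gives u_ij u_kl (x) u_jm u_ln, a
    tensor product of nonzero elements.

    Actions.  [d u = u d] holds exactly when [d] is constant on the classes of
    ~ ([acts_on_graphP]): multiplying the (i, b) entry by u_ia on the left and
    u_kb on the right isolates d_ik u_ia u_kb = d_ab u_ia u_kb, and conversely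
    inserting a full row or column, which sums to 1, on each side of the
    equation reduces it to these identities.

    The theorem follows, because the unions of orbitals are the sets that ~
    preserves, and the flip (i, k) |-> (k, i) preserves ~. *)

(** * Stars and C*-norms *)

Section StarAlgebra.
Variables (K : numClosedFieldType) (A : starAlgType K).
Implicit Types x : A.

Lemma star1 : star (1 : A) = 1.
Proof. by rewrite -[LHS]mulr1 -{2}(starK 1) -starM mulr1 starK. Qed.

Lemma star0 : star (0 : A) = 0.
Proof. by rewrite -(scale0r (0 : A)) starZ conjC0 !scale0r. Qed.

Lemma star_eq0 x : (star x == 0) = (x == 0).
Proof. by rewrite -{1}star0 (inj_eq (inv_inj (@starK _ A))). Qed.

Lemma starN x : star (- x) = - star x.
Proof. by rewrite -scaleN1r starZ rmorphN rmorph1 scaleN1r. Qed.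

Lemma is_projection1 : is_projection (1 : A).
Proof. by split; rewrite ?mulr1 ?star1. Qed.

Lemma conjC_sqrtN1 (c : K) : c ^+ 2 = -1 -> c^* = - c.
Proof.
rewrite -(@sqrCi K) => /eqP; rewrite eqf_sqr => /orP[] /eqP ->.
  exact: conjCi.
by rewrite rmorphN /= conjCi.
Qed.

End StarAlgebra.

Section Norm.
Variables (R : realType) (A : cstarAlgType R).
Implicit Types (a e p x y : A) (c d : R[i]).

Lemma cnormZ_unity n c x : c ^+ n.+1 = 1 -> cnorm (c *: x) = cnorm x.
Proof.
move=> cn1; rewrite cnormZ.
suff -> : Normc.normc c = 1 by rewrite mul1r.
have c_ge0 : 0 <= Normc.normc c by case: (c) => u v; exact: sqrtr_ge0.
have normX k : Normc.normc (c ^+ k) = Normc.normc c ^+ k.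
  by elim: k => [|k IH]; rewrite ?Normc.normc1 // !exprS Normc.normcM IH.
by apply/eqP; rewrite -(@pexpr_eq1 _ _ n.+1) // -normX cn1 Normc.normc1.
Qed.

Lemma cnormN x : cnorm (- x) = cnorm x.
Proof. by rewrite -scaleN1r (@cnormZ_unity 1) // sqrrN expr1n. Qed.

Lemma cnormMn n x : cnorm (x *+ n) = cnorm x *+ n.
Proof.
rewrite -scaler_nat cnormZ -[RHS]mulr_natl.
by rewrite (@normcMn R 1 n) Normc.normc1.
Qed.

Lemma cnorm0 : cnorm (0 : A) = 0.
Proof. by rewrite -(mulr0n 0) cnormMn. Qed.

Lemma le_cnorm_sum (I : finType) (P : pred I) (F : I -> A) (C : R) :
    (forall i, cnorm (F i) <= C) ->
  cnorm (\sum_(i | P i) F i) <= C *+ #|P|.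
Proof.
move=> leFC; rewrite -sumr_const.
elim/big_ind2: _ => [|x C1 y C2 le1 le2|i _]; rewrite ?cnorm0 //.
by apply: le_trans (cnormD _ _) _; apply: lerD.
Qed.

Lemma cnorm_projection p : is_projection p -> cnorm p <= 1.
Proof.
case=> pp sp; have := cnorm_star_mul p; rewrite sp pp.
move: (cnorm_ge0 p); set r := cnorm p => r0 rr; nra.
Qed.

(** A self-adjoint element of square 1 is unitary. *)
Lemma cnorm_symmetry p : is_projection p -> cnorm (1 - p *+ 2) <= 1.
Proof.
case=> pp sp; rewrite -(@ler_pXn2r _ 2) ?nnegrE ?cnorm_ge0 //.
rewrite expr1n -cnorm_star_mul.
have -> : star (1 - p *+ 2) = 1 - p *+ 2.
  by rewrite starD star1 starN mulr2n starD sp.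
suff -> : (1 - p *+ 2) * (1 - p *+ 2) = 1.
  exact: cnorm_projection (is_projection1 A).
rewrite mulrBl mul1r mulrBr mulr1 mulrnAl mulrnAr pp.
by move: (p *+ 2) => q; rewrite mulr2n opprB addrK subrK.
Qed.

(** * The unit of a corner is an extreme point of its unit ball *)

Lemma sqr_unit_perturb e a c : e * e = e -> e * a = a -> a * e = a ->
  (e + c *: a) * (e + c *: a) = e + (c + c) *: a + (c * c) *: (a * a).
Proof.
move=> ee ea ae; rewrite mulrDl !mulrDr ee -!scalerAl -!scalerAr ea ae scalerA.
by rewrite scalerDl !addrA.
Qed.

(** The doubling step averages over c and i c to cancel the terms in [a * a],
    so the set of directions has to be stable under multiplication by i. *)
Definition quarter_turn_contractive e a :=
  forall c, c ^+ 4 = 1 -> cnorm (e + c *: a) <= 1.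

Lemma quarter_turn_contractiveZ e a d : d ^+ 4 = 1 ->
  quarter_turn_contractive e a -> quarter_turn_contractive e (d *: a).
Proof.
move=> d4 ha c c4; rewrite scalerA; apply: ha.
by rewrite exprMn c4 d4 mulr1.
Qed.

(** The average of the squares of the contractions [e + c *: a] and
    [e + (c * 'i) *: a] is [e + (c * (1 + 'i)) *: a]. *)
Lemma quarter_turn_contractive_diag e a :
    e * e = e -> e * a = a -> a * e = a -> quarter_turn_contractive e a ->
  quarter_turn_contractive e ((1 + 'i) *: a).
Proof.
move=> ee ea ae ha c c4.
have i4 : 'i ^+ 4 = 1 :> R[i] by rewrite (exprM _ 2 2) sqrCi sqrrN expr1n.
have ci4 : (c * 'i) ^+ 4 = 1 by rewrite exprMn c4 i4 mulr1.
have sq : (e + c *: a) * (e + c *: a) +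
    (e + (c * 'i) *: a) * (e + (c * 'i) *: a) =
    (e + c *: ((1 + 'i) *: a)) *+ 2.
  rewrite !sqr_unit_perturb // mulrACA -(expr2 'i) sqrCi mulrN1 scaleNr.
  rewrite addrACA subrr addr0 addrACA -scalerDl -!mulr2n.
  by rewrite scalerA mulrDr mulr1 mulrnDl (scalerMnl (c + _) a) mulrnDl.
have := cnormD ((e + c *: a) * (e + c *: a))
  ((e + (c * 'i) *: a) * (e + (c * 'i) *: a)).
rewrite sq cnormMn.
have := cnormM (e + c *: a) (e + c *: a).
have := cnormM (e + (c * 'i) *: a) (e + (c * 'i) *: a).
have := ha _ c4; have := ha _ ci4.
have := cnorm_ge0 (e + c *: a); have := cnorm_ge0 (e + (c * 'i) *: a).
nra.
Qed.

(** [(1 + 'i) ^+ 2 = 2 * 'i], and the factor ['i] is harmless. *)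
Lemma quarter_turn_contractive_double e a :
    e * e = e -> e * a = a -> a * e = a -> quarter_turn_contractive e a ->
  quarter_turn_contractive e (a *+ 2).
Proof.
move=> ee ea ae ha.
have -> : a *+ 2 = - 'i *: ((1 + 'i) *: ((1 + 'i) *: a)).
  rewrite -scaler_nat !scalerA; congr (_ *: _).
  rewrite -expr2 sqrrD expr1n sqrCi mul1r addrAC subrr add0r.
  by rewrite mulrnAr mulNr -expr2 sqrCi opprK.
apply: quarter_turn_contractiveZ.
  by rewrite (exprM _ 2 2) sqrrN sqrCi sqrrN expr1n.
have ea' : e * ((1 + 'i) *: a) = (1 + 'i) *: a by rewrite -scalerAr ea.
have ae' : ((1 + 'i) *: a) * e = (1 + 'i) *: a by rewrite -scalerAl ae.
apply: quarter_turn_contractive_diag => //.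
exact: quarter_turn_contractive_diag.
Qed.

(** All [a *+ 2 ^ n] satisfy the hypothesis, which bounds their norms by 1. *)
Lemma quarter_turn_contractive_eq0 e a :
    e * e = e -> e * a = a -> a * e = a -> quarter_turn_contractive e a ->
  a = 0.
Proof.
move=> ee ea ae ha; apply: cnorm_eq0; apply/eqP.
have hn n : quarter_turn_contractive e (a *+ 2 ^ n).
  elim: n => [|n IH]; first by rewrite expn0.
  rewrite expnS mulnC mulrnA; apply: quarter_turn_contractive_double => //.
    by rewrite mulrnAr ea.
  by rewrite mulrnAl ae.
have bd n : cnorm a *+ 2 ^ n <= 1.
  have h1 := hn n 1 (expr1n _ _).
  rewrite scale1r in h1; rewrite -cnormMn.
  have hm : cnorm (e - a *+ 2 ^ n) <= 1.
    by rewrite -scaleN1r; apply: hn; rewrite (exprM _ 2 2) sqrrN !expr1n.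
  have := cnormD (e + a *+ 2 ^ n) (- (e - a *+ 2 ^ n)).
  have -> : e + a *+ 2 ^ n - (e - a *+ 2 ^ n) = a *+ 2 ^ n *+ 2.
    by rewrite opprB addrC addrA subrK mulr2n.
  rewrite cnormN (cnormMn 2); lra.
rewrite eq_le cnorm_ge0 andbT leNgt; apply/negP => a_gt0.
have := archi_boundP (ltW (divr_gt0 ltr01 a_gt0)); set n := Num.bound _.
rewrite ltr_pdivrMr // mulr_natl => /lt_le_trans /(_ _) lt1.
have := bd n; rewrite leNgt lt1 //.
by rewrite -!(mulr_natl (cnorm a)) ler_pM2r // ler_nat ltnW // ltn_expl.
Qed.

(** For self-adjoint [a], the real directions control the imaginary ones: by
    the C*-identity the squared norm of [e + c *: a], for c^2 = -1, is the norm
    of [e + a * a], the average of the squares of [e + a] and [e - a]. *)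
Lemma selfadjoint_extremal_eq0 e a :
    e * e = e -> star e = e -> star a = a -> e * a = a -> a * e = a ->
    cnorm (e + a) <= 1 -> cnorm (e - a) <= 1 -> a = 0.
Proof.
move=> ee se sa ea ae hp hm.
apply: (@quarter_turn_contractive_eq0 e) => // c c4.
have : c ^+ 2 == 1 \/ c ^+ 2 == -1.
  by apply/orP; rewrite -sqrf_eq1 -exprM c4.
case=> [|/eqP c2].
  by rewrite sqrf_eq1 => /orP[] /eqP ->; rewrite ?scaleN1r ?scale1r.
have sc : c^* = - c by exact: conjC_sqrtN1.
rewrite -(@ler_pXn2r _ 2) ?nnegrE ?cnorm_ge0 // expr1n -cnorm_star_mul.
have aE : (e - c *: a) * (e + c *: a) = e + a * a.
  rewrite mulrBl !mulrDr ee -!scalerAl -!scalerAr ea ae scalerA -expr2 c2.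
  by rewrite scaleN1r opprD opprK addrA addrK.
rewrite starD starZ se sa sc scaleNr aE.
have := cnormD ((e + a) * (e + a)) ((e - a) * (e - a)).
have -> : (e + a) * (e + a) + (e - a) * (e - a) = (e + a * a) *+ 2.
  rewrite mulrDl mulrBl !mulrDr !mulrN ee ea ae opprB.
  rewrite addrACA (addrC a (a * a)) (addrACA e) (addrACA (a * a)).
  by rewrite subrr !addr0 mulrnDl !mulr2n.
rewrite cnormMn; have := cnormM (e + a) (e + a); have := cnormM (e - a) (e - a).
have := cnorm_ge0 (e + a); have := cnorm_ge0 (e - a).
nra.
Qed.

(** With [e = p j] and [y k = e * p k * e], the sum of the [y k] over [k != j]
    vanishes.  As each [e - y k *+ 2] is a contraction, summing over the [m]
    indices other than [i] and [j] bounds [e *+ m + y i *+ 2] by [m], while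
    [e - y i *+ 2] is bounded by 1: up to the factor [m.+1], both signs of [y i]
    perturb [e] within the unit ball, and extremality gives [y i = 0].  The
    norm of [y i] is the squared norm of [p i * e]. *)
Lemma projections_sum1_orthogonal (I : finType) (p : I -> A) :
    (forall i, is_projection (p i)) -> \sum_i p i = 1 ->
  forall i j, i != j -> p i * p j = 0.
Proof.
move=> pP p1 i j ij; pose e := p j; have [ee se] := pP j.
pose y k := e * p k * e.
suff yi0 : y i = 0.
  apply: cnorm_eq0; apply/eqP; rewrite -sqrf_eq0 -cnorm_star_mul starM.
  case: (pP i) => pp ->; rewrite se mulrA -(mulrA e (p i)) pp -/e -/(y i).
  by rewrite yi0 cnorm0.
have ey k : e * y k = y k by rewrite /y !mulrA ee.
have ye k : y k * e = y k by rewrite /y -!mulrA ee.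
have sy k : star (y k) = y k by rewrite /y !starM se (pP k).2 mulrA.
have sumy : \sum_(k | k != j) y k = 0.
  have: \sum_k y k = e by rewrite -mulr_suml -mulr_sumr p1 mulr1.
  rewrite (bigD1 j) //= /y ee -/e => /eqP.
  by rewrite ee -subr_eq0 addrAC subrr add0r => /eqP.
have contr k : cnorm (e - y k *+ 2) <= 1.
  have -> : e - y k *+ 2 = e * (1 - p k *+ 2) * e.
    by rewrite mulrBr mulr1 mulrBl ee mulrnAr mulrnAl.
  have := cnormM (e * (1 - p k *+ 2)) e; have := cnormM e (1 - p k *+ 2).
  have := cnorm_symmetry (pP k); have := cnorm_projection (pP j).
  have := cnorm_ge0 e; have := cnorm_ge0 (1 - p k *+ 2).
  have := cnorm_ge0 (e * (1 - p k *+ 2)); rewrite -/e; nra.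
pose m := #|[pred k | (k != j) && (k != i)]|.
have sumE : \sum_(k | (k != j) && (k != i)) (e - y k *+ 2) = e *+ m + y i *+ 2.
  rewrite sumrB sumr_const sumrMnl; congr (_ + _).
  move: sumy; rewrite (bigD1 i) //= => /eqP; rewrite addr_eq0 => /eqP ->.
  by rewrite mulNrn.
have le_e : cnorm e <= 1 by exact: cnorm_projection.
have le_plus : cnorm (e *+ m.+1 + y i *+ 2) <= m.+1%:R.
  rewrite mulrS -addrA -sumE; apply: le_trans (cnormD _ _) _.
  by rewrite -nat1r lerD // le_cnorm_sum.
have le_minus : cnorm (e *+ m.+1 - y i *+ 2) <= m.+1%:R.
  rewrite mulrS addrAC; apply: le_trans (cnormD _ _) _.
  rewrite -nat1r; apply: lerD; first exact: contr.
  by rewrite cnormMn lerMn2r le_e orbT.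
pose h := m.+1%:R^-1 *: (y i *+ 2).
have hM : h *+ m.+1 = y i *+ 2.
  by rewrite -scaler_nat scalerA mulfV ?scale1r // pnatr_eq0.
have h0 : h = 0.
  apply: (@selfadjoint_extremal_eq0 e) => //.
  - by rewrite starZ fmorphV /= conjC_nat mulr2n starD sy.
  - by rewrite -scalerAr mulrnAr ey.
  - by rewrite -scalerAl mulrnAl ye.
  - by rewrite -(@ler_pMn2r _ m.+1) // -cnormMn mulrnDl hM.
  - by rewrite -(@ler_pMn2r _ m.+1) // -cnormMn mulrnBl hM.
move: hM; rewrite h0 mul0rn => /esym/eqP.
by rewrite -scaler_nat scaler_eq0 pnatr_eq0 => /eqP.
Qed.

End Norm.

(** * Elementary tensors and magic matrices *)

Lemma linear_map0 (K : pzRingType) (U V : lmodType K) (f : U -> V) :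
  linear f -> f 0 = 0.
Proof.
by move=> lf; rewrite -[in LHS](addNr 0) -scaleN1r lf scaleN1r addNr.
Qed.

(** A nonzero left factor is a linearly independent family of length 1. *)
Lemma tensor_eq0 (R : realType) (A B T : cstarAlgType R) (t : A -> B -> T) x y :
  is_cstar_tensor t -> t x y = 0 -> x = 0 \/ y = 0.
Proof.
move=> tT txy; have [->|x_neq0] := eqVneq x 0; [by left | right].
apply: (cstar_tensor_inj tT (n := 1) (a := fun=> x) (b := fun=> y)) ord0.
  move=> c; rewrite big_ord1 => /eqP; rewrite scaler_eq0 (negPf x_neq0) orbF.
  by move=> /eqP c0 i; rewrite ord1.
by rewrite big_ord1.
Qed.

Section Magic.
Variables (R : realType) (A : cstarAlgType R) (N : nat) (u : 'M[A]_N).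
Hypothesis uP : magic_mx u.

Lemma magic_row_mul i a b : u i a * u i b = u i a *+ (a == b).
Proof.
have [->|ab] := eqVneq a b; first by rewrite (magic_projection uP i b).1.
apply: (projections_sum1_orthogonal (p := u i)) ab => [j|].
  exact: magic_projection.
exact: magic_row.
Qed.

Lemma magic_col_mul j a b : u a j * u b j = u a j *+ (a == b).
Proof.
have [->|ab] := eqVneq a b; first by rewrite (magic_projection uP b j).1.
apply: (projections_sum1_orthogonal (p := u^~ j)) ab => [i|].
  exact: magic_projection.
exact: magic_col.
Qed.

End Magic.

(** * Orbitals *)

Section Orbitals.
Variables (R : realType) (N : nat) (G : compactQuantumGroup R N).
Hypothesis hG : quantum_permutation_group G.
Local Notation u := (cqg_mx G).
Implicit Types (p q : 'I_N * 'I_N) (X : graph N).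

(** The counit maps the product of two diagonal entries to 1. *)
Lemma orbital_rel_refl : reflexive (orbital_rel G).
Proof.
move=> [i k]; apply/negP => /eqP /= uu0.
have [eps [epsP epsE]] := cqg_counit G.
have := star_homM epsP (u i i) (u k k); rewrite !epsE uu0 !eqxx.
rewrite (linear_map0 (star_hom_linear epsP)) mulr1 => /esym/eqP.
by rewrite oner_eq0.
Qed.

(** The star exchanges the factors of the product. *)
Lemma orbital_rel_swap p q :
  orbital_rel G (p.2, p.1) (q.2, q.1) = orbital_rel G p q.
Proof.
rewrite /orbital_rel /= -star_eq0 starM.
by rewrite !(magic_projection hG _ _).2.
Qed.

(** The antipode transposes the self-adjoint matrix [u] and reverses the
    product, and the star restores the order of the factors. *)
Lemma orbital_rel_sym : symmetric (orbital_rel G).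
Proof.
suff sym p q : orbital_rel G p q -> orbital_rel G q p.
  by move=> p q; apply/idP/idP; apply: sym.
have [S [SP SE]] := cqg_antipode G.
rewrite -orbital_rel_swap; apply: contra_neq => uu0.
have := star_antihomM SP (u q.1 p.1) (u q.2 p.2); rewrite uu0 !SE.
rewrite (linear_map0 (star_antihom_linear SP)) => /esym.
by rewrite !(magic_projection hG _ _).2.
Qed.

(** Orthogonality along rows makes [t (u i j) (u j m)] pick the summand [j] of
    [Delta (u i m)], and likewise on the right, so that the vanishing of
    [u i m * u k n] would force that of a tensor of two nonzero elements. *)
Lemma orbital_rel_trans : transitive (orbital_rel G).
Proof.
move=> [j l] [i k] [m n]; rewrite /orbital_rel /= => ne1 ne2.
apply/negP => /eqP uu0.
have [T [t [[tT _] [Delta [DP DE]]]]] := cqg_comult G.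
have t0l y : t 0 y = 0 := linear_map0 (cstar_tensor_linl tT y).
have absl : t (u i j) (u j m) * Delta (u i m) = t (u i j) (u j m).
  rewrite DE mulr_sumr (bigD1 j) //= big1 ?addr0 => [|a aj].
    by rewrite -cstar_tensorM // !(magic_projection hG _ _).1.
  by rewrite -cstar_tensorM // (magic_row_mul hG) eq_sym (negPf aj) t0l.
have absr : Delta (u k n) * t (u k l) (u l n) = t (u k l) (u l n).
  rewrite DE mulr_suml (bigD1 l) //= big1 ?addr0 => [|b bl].
    by rewrite -cstar_tensorM // !(magic_projection hG _ _).1.
  by rewrite -cstar_tensorM // (magic_row_mul hG) (negPf bl) t0l.
have : t (u i j * u k l) (u j m * u l n) = 0.
  rewrite cstar_tensorM // -absl -absr mulrA -(mulrA _ _ (Delta _)).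
  rewrite -(star_homM DP) uu0 (linear_map0 (star_hom_linear DP)).
  by rewrite mulr0 mul0r.
by case/(tensor_eq0 tT) => /eqP; apply/negP.
Qed.

Lemma orbital_mem_rel o p q : o \in orbitals G -> orbital_rel G p q ->
  (p \in o) = (q \in o).
Proof.
move=> /imsetP[r _ ->] pq; rewrite !inE /=.
by rewrite ![orbital_rel G r _]orbital_rel_sym
  (sym_left_transitive orbital_rel_sym orbital_rel_trans pq).
Qed.

(** * Actions on graphs *)

(** Sandwiching an entry of [d u = u d] between [u i a] and [u k b] isolates one
    summand on each side, by orthogonality along columns and rows.  Conversely,
    multiplying each summand of [d u] by the sum of row [i], and each summand of
    [u d] by the sum of column [j], turns both sides into double sums that
    agree term by term. *)
Lemma acts_on_graphP X :
  acts_on_graph G X <->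
  (forall p q, orbital_rel G p q -> (p \in edges X) = (q \in edges X)).
Proof.
split=> [duud [i k] [a b] ne | edgesE].
  have /matrixP/(_ i b) := duud; rewrite !mxE => duud_ib.
  have : u i a * (\sum_l adjacency_mx _ X i l * u l b) * u k b =
         u i a * (\sum_l u i l * adjacency_mx _ X l b) * u k b.
    by rewrite duud_ib.
  rewrite !mulr_sumr !mulr_suml (bigD1 k) //= [in RHS](bigD1 a) //=.
  rewrite big1 => [|l lk]; last first.
    rewrite mxE mulr_natl -!mulrA mulrnAl magic_col_mul // (negPf lk).
    by rewrite mul0rn mulr0.
  rewrite big1 => [|l la]; last first.
    by rewrite mxE mulrA magic_row_mul // eq_sym (negPf la) !mul0r.
  rewrite !mxE !addr0 mulr_natl mulr_natr !mulrnAr !mulrnAl.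
  rewrite (magic_projection hG i a).1 -(mulrA (u i a) (u k b)).
  rewrite (magic_projection hG k b).1.
  move: ne; rewrite /orbital_rel /=; set x := _ * _ => /eqP x0.
  by case: (_ \in _); case: (_ \in _) => // xE; case: x0.
apply/matrixP => i j; rewrite !mxE.
transitivity (\sum_k \sum_l adjacency_mx _ X i k * (u i l * u k j)).
  apply: eq_bigr => k _; rewrite -mulr_sumr -mulr_suml (magic_row hG).
  by rewrite mul1r.
rewrite exchange_big; apply: eq_bigr => l _.
transitivity (\sum_k u i l * u k j * adjacency_mx _ X l j); last first.
  by rewrite -mulr_suml -mulr_sumr (magic_col hG) mulr1.
apply: eq_bigr => k _; rewrite !mxE mulr_natl mulr_natr.
have [->|ne] := eqVneq (u i l * u k j) 0; first by rewrite !mul0rn.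
by rewrite (edgesE (i, k) (l, j) ne).
Qed.

End Orbitals.

Lemma graph_inj N : injective (@edges N).
Proof.
move=> [E s r] [E' s' r'] /= EE'; case: _ / EE' in s' r' *.
by congr Graph; apply: bool_irrelevance.
Qed.

Theorem theorem5p5 (R : realType) (N : nat) (G : compactQuantumGroup R N)
    (hG : quantum_permutation_group G) :
  (forall (A : {set {set 'I_N * 'I_N}}) (sAO : A \subset offdiag_orbitals G),
      acts_on_graph G (orbital_graph sAO)) /\
  (forall X : graph N, acts_on_graph G X ->
      exists (A : {set {set 'I_N * 'I_N}}) (sAO : A \subset offdiag_orbitals G),
        X = orbital_graph sAO).
Proof.
split=> [A sAO | X /(acts_on_graphP hG) edgesE].
  apply/(acts_on_graphP hG) => p q pq.
  have mem_cong o : o \in A ->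
      (p \in o :|: converse_rel o) = (q \in o :|: converse_rel o).
    move=> /(fintype.subsetP sAO); rewrite inE => /andP[oG _].
    rewrite !inE (orbital_mem_rel hG oG pq); congr (_ || _).
    apply: (orbital_mem_rel hG oG).
    by rewrite (orbital_rel_swap hG (_, _) (_, _)).
  by apply/bigcupP/bigcupP => -[o oA]; rewrite ?mem_cong // => qo;
    exists o; rewrite ?mem_cong.
pose A := [set o in offdiag_orbitals G | o \subset edges X]%SET.
have sAO : A \subset offdiag_orbitals G.
  by apply/fintype.subsetP => o; rewrite inE => /andP[].
exists A, sAO; apply: graph_inj; apply/finset.setP => p.
apply/idP/bigcupP => [pX | [o]].
  pose o := [set q in [set: 'I_N * 'I_N] | orbital_rel G p q]%SET.
  have oX : o \subset edges X.
    by apply/fintype.subsetP => q; rewrite !inE => /edgesE <-.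
  (* [o] avoids the diagonal because it lies in the irreflexive [edges X]. *)
  exists o; last by rewrite !inE orbital_rel_refl.
  rewrite !inE oX andbT; apply/andP; split; first exact: imset_f.
  rewrite disjoint_sym disjoint_subset; apply/fintype.subsetP => -[i k].
  rewrite inE /= => /eqP <-; apply: contra (forallP (edges_irr X) i) => /=.
  exact: (fintype.subsetP oX).
rewrite inE => /andP[_ /fintype.subsetP oX]; rewrite !inE => /orP[/oX //|/oX].
by case: p => i k /(implyP (forallP (forallP (edges_sym X) _) _)).
Qed.
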